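(* Let $G$ be a countable amenable group and let $H$ be a countable group. Suppose there exists a free $G$-chart $(X,\gamma)$ of $H$ such that $X$ is a nonempty $G$-SFT. Then for every $\varepsilon >0$ there exists a free $G$-chart $(Y,\gamma')$ of $H$ such that $Y$ is a nonempty $G$-SFT and $h_{\mathrm{top}}(G \curvearrowright Y) \leq \varepsilon$.
   Context: Groups are discrete. For a countable group $G$ and a finite set $\Sigma$, $\Sigma^G$ carries the product topology and the left action $(gx)(h)=x(hg)$. A $G$-subshift is a closed $G$-invariant subset of $\Sigma^G$ for some finite $\Sigma$. A pattern is an element $p\in\Sigma^F$ with $F\subset G$ finite, and $[p]=\{x\in\Sigma^G: x|_F=p\}$. A subshift $X\subset\Sigma^G$ is of finite type ($G$-SFT) if there is a finite set $\mathcal{F}$ of patterns with $X=\Sigma^G\setminus\bigcup_{p\in\mathcal{F},g\in G}g[p]$. For finite $F\subset G$, $L_F(X)=\{x|_F : x\in X\}$. For $G$ countable amenable and $X$ a nonempty $G$-subshift, $h_{\mathrm{top}}(G\curvearrowright X)=\lim_{n}\frac{1}{|F_n|}\log|L_{F_n}(X)|$, where $(F_n)$ is any sequence of nonempty finite subsets of $G$ with $|KF_n\triangle F_n|/|F_n|\to 0$ for every finite $K\subset G$ (the limit exists and does not depend on the sequence). Let $X$ be a $G$-subshift. An $H$-cocycle is a continuous map $\gamma\colon H\times X\to G$ with $\gamma(1_H,x)=1_G$ and $\gamma(h_1h_2,x)=\gamma(h_1,\gamma(h_2,x)x)\,\gamma(h_2,x)$ for all $h_1,h_2\in H$, $x\in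 X$. For each $x\in X$ it induces a left action of $H$ on the set $G$ by $h\cdot_x g=\gamma(h,gx)g$. The pair $(X,\gamma)$ is called a $G$-chart of $H$; it is a free $G$-chart if for every $x\in X$ the action $\cdot_x$ of $H$ on $G$ is free (that is, $h\cdot_x g=g$ for some $g$ implies $h=1_H$).
   Formalization: The countable amenable group G is assumed to be infinite: for finite G the claim fails, e.g. G = Z/6 and H = S_3, where small entropy forces a one-point Y and hence an embedding of H in G. In the Følner condition K ranges over nonempty finite sets. *)

(* Defs.v *)
From mathcomp Require Import all_boot all_order all_algebra finmap.
From mathcomp Require Import all_classical all_reals all_analysis.

Set Implicit Arguments.
Unset Strict Implicit.
Unset Printing Implicit Defensive.

Import Order.TTheory GRing.Theory Num.Theory.
Import numFieldNormedType.Exports.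

Local Open Scope classical_set_scope.
Local Open Scope ring_scope.

(* [G -> A] with the product topology, where [A] is discrete. *)
Definition config (G : Type) (A : finType) :=
  {ptws G -> discrete_topology A}.

Section Subshifts.
Variables (G : groupType) (A : finType).
Implicit Types (x : config G A) (X : set (config G A)).

Definition translate (g : G) x : config G A := fun h => x (h * g)%g.

Definition subshift X :=
  closed X /\ forall g x, X x -> X (translate g x).

Definition restr (F : {fset G}) x : {ffun F -> A} := [ffun g => x (val g)].

Definition pattern := {F : {fset G} & {ffun F -> A}}.

Definition cylinder (p : pattern) : set (config G A) :=
  [set x | restr (projT1 p) x = projT2 p].

Definition SFT X := exists2 P : set pattern, finite_set P &
  X = ~` \bigcup_(p in P) \bigcup_(g in [set: G]) (translate g @` cylinder p).

Definition language (F : {fset G}) X : set {ffun F -> A} := restr F @` X.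

End Subshifts.

Arguments restr {G A} F x.
Arguments language {G A} F X.

Section Entropy.
Variable R : realType.

Definition setmul (G : groupType) (K F : {fset G}) : {fset G} :=
  [fset (k * g)%g | k in K, g in F]%fset.

Definition symdiff (G : groupType) (E F : {fset G}) : {fset G} :=
  ((E `\` F) `|` (F `\` E))%fset.

(* [K] ranges over nonempty sets: for empty [K] the ratio is constantly 1. *)
Definition Folner (G : groupType) (F : nat -> {fset G}) :=
  (forall n, F n != fset0) /\
  forall K : {fset G}, K != fset0 ->
    ((#|` symdiff (setmul K (F n)) (F n)|%:R / #|` F n|%:R : R)
       @[n --> \oo] --> (0 : R)).

(* For countable groups this is equivalent to the existence of an invariant
   mean. *)
Definition amenable (G : groupType) := exists F : nat -> {fset G}, Folner F.

(* [h] is the limit of the normalized (natural) logarithms along every Folner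
   sequence; for amenable [G] there is at most one such [h]. *)
Definition is_htop (G : groupType) (A : finType) (X : set (config G A))
    (h : R) :=
  forall F : nat -> {fset G}, Folner F ->
    (ln (#|language (F n) X|%:R : R) / #|` F n|%:R @[n --> \oo] --> h).

End Entropy.

Section Charts.
Variables (G H : groupType) (A : finType).
Implicit Types (X : set (config G A)).

(* A map [H * X -> G] is represented by a total function on [H * A^G] whose
   values outside [X] are irrelevant. *)
Definition cocycle X
    (gamma : discrete_topology H * config G A -> discrete_topology G) :=
  [/\ {within [set: discrete_topology H] `*` X, continuous gamma},
      forall x, X x -> gamma (1%g : H, x) = (1%g : G) &
      forall (h1 h2 : H) x, X x ->
        gamma ((h1 * h2)%g, x) =
        ((gamma (h1, translate (gamma (h2, x)) x) : G) *
          (gamma (h2, x) : G))%g :> G].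

Definition chart_act
    (gamma : discrete_topology H * config G A -> discrete_topology G)
    (x : config G A) (h : H) (g : G) : G :=
  ((gamma (h, translate g x) : G) * g)%g.

Definition chart X gamma := subshift X /\ cocycle X gamma.

Definition free_chart X gamma :=
  chart X gamma /\
  forall x, X x -> forall h g, chart_act gamma x h g = g -> h = 1%g.

End Charts.

(* Main.v *)
(* It suffices to find [y] in [X] and a finite window [K] such that the orbit of
   [y] shows at most [exp (eps * |K|)] patterns on [K]: the configurations of [X]
   all of whose [K]-patterns occur in the orbit of [y] then form an SFT [Y] inside
   [X], the chart restricts to [Y], and Shearer's inequality bounds the entropy
   by the rate on any single window.

   To build [y], take one large, very invariant tile [T] and choose translates
   [T c] in finitely many rounds. Within a round the tiles are disjoint, and each
   covers at least [delta * |T|] points not covered in earlier rounds. Once no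
   further such translate exists, every translate of [T] has fewer than
   [delta * |T|] uncovered points, so the uncovered set has density about
   [delta], while the centers have density at most [1 / (delta * |T|)]. Start
   from any [x0] in [X]; in each round overwrite every tile by a filling that
   depends only on what is visible on the thin inner boundary of the tile. The
   result is coded by the sparse set of centers with their rounds and boundary
   patterns, and by [x0] on the sparse uncovered set. Overlaps between tiles of
   different rounds are harmless since later rounds simply overwrite. *)
Require Import Defs.
From mathcomp Require Import all_boot all_order all_algebra finmap.
From mathcomp Require Import all_classical all_reals all_analysis.
From mathcomp Require Import ring lra zify.

Set Implicit Arguments.
Unset Strict Implicit.
Unset Printing Implicit Defensive.

Import Order.TTheory GRing.Theory Num.Theory.
Import numFieldNormedType.Exports.

Local Open Scope classical_set_scope.
Local Open Scope ring_scope.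

(** Counts patterns through codes: a choice of preimages under [c1], followed by [c2], is
    injective. *)
Lemma card_image_le (I : Type) (T1 T2 : finType) (c1 : I -> T1) (c2 : I -> T2)
    (S : set I) :
  (forall x y, S x -> S y -> c2 x = c2 y -> c1 x = c1 y) ->
  (#|c1 @` S| <= #|c2 @` S|)%N.
Proof.
move=> c12; have [->|/set0P[x0 Sx0]] := eqVneq S set0.
  by rewrite !image_set0 [X in (X <= _)%N]eq_card0// => p; exact: memNset.
have /choice[f fP] (p : T1) :
    exists x, (exists2 y, S y & c1 y = p) -> S x /\ c1 x = p.
  have [[y Sy yp]|nex] := pselect (exists2 y, S y & c1 y = p).
    by exists y.
  by exists x0 => ex; case: nex.
have fS p : p \in c1 @` S -> S (f p) /\ c1 (f p) = p by rewrite inE; exact: fP.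
have inj : {in c1 @` S &, injective (c2 \o f)}.
  by move=> p q /fS[Sp Ep] /fS[Sq Eq] /= pq; rewrite -Ep -Eq; exact: c12.
rewrite -(card_in_imset inj); apply/subset_leq_card/fintype.subsetP => q.
by move=> /imsetP[p /fS[Sp _] ->]; rewrite inE /=; exists (f p).
Qed.

(** * Shearer's inequality for languages *)

Section Shearer.
Variables (R : realType) (G : groupType) (A : finType).
Implicit Types (S X : set (config G A)) (F K : {fset G}).

Definition slice (t : G) (a : A) S := [set x | S x /\ x t = a].

Lemma restrP F (x y : config G A) :
  restr F x = restr F y <-> forall u, u \in F -> x u = y u.
Proof.
split=> [xy u uF|xy].
  by have /ffunP/(_ [` uF]%fset) := xy; rewrite !ffunE.
by apply/ffunP => u; rewrite !ffunE; apply: xy; exact: valP.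
Qed.

Lemma card_language_sub S S' F : S `<=` S' ->
  (#|language F S| <= #|language F S'|)%N.
Proof.
move=> sub; apply/subset_leq_card/fintype.subsetP => p; rewrite !inE.
by case=> x /sub S'x <-; exists x.
Qed.

Lemma card_language_gt0 S F : S !=set0 -> (0 < #|language F S|)%N.
Proof.
by case=> x Sx; apply/card_gt0P; exists (restr F x); rewrite inE; exists x.
Qed.

Lemma card_language_slices S F (t : G) : t \in F ->
  #|language F S| = (\sum_(a : A) #|language F (slice t a S)|)%N.
Proof.
move=> tF; rewrite -sum1_card.
rewrite (partition_big (fun p : {ffun F -> A} => p [` tF]%fset) xpredT) //=.
apply: eq_bigr => a _; rewrite -sum1_card; apply: eq_bigl => p.
apply/idP/idP.
  move=> /andP[]; rewrite inE => -[x Sx <-] /eqP; rewrite ffunE /= => xa.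
  by rewrite inE; exists x.
rewrite inE => -[x [Sx xa] <-]; apply/andP; split; first by rewrite inE; exists x.
by rewrite ffunE /= xa.
Qed.

Lemma card_language_sliceU1 S F (t : G) (a : A) :
  (#|language (t |` F)%fset (slice t a S)| <= #|language F (slice t a S)|)%N.
Proof.
apply: card_image_le => x y [_ xa] [_ ya] /restrP xy; apply/restrP => u.
by rewrite !inE => /orP[/eqP->|/xy//]; rewrite xa.
Qed.

(** Termwise this is [ln (1 + x) <= x] at [x = M a / (\sum_a M a) / p a - 1]; where [p a = 0] the
    left side vanishes whatever value [ln] takes at zero. *)
Lemma gibbs (p M : A -> R) :
  (forall a, 0 <= p a) -> \sum_a p a = 1 ->
  (forall a, 0 <= M a) -> (forall a, 0 < p a -> 0 < M a) ->
  \sum_a p a * (ln (M a) - ln (p a)) <= ln (\sum_a M a).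
Proof.
move=> p0 p1 M0 pM.
have Mgt0 : 0 < \sum_a M a.
  rewrite lt_neqAle sumr_ge0// andbT eq_sym; apply/eqP => M00.
  have M0a a : M a = 0.
    by move/eqP: M00; rewrite psumr_eq0// => /allP/(_ a); rewrite mem_index_enum => /(_ isT)/eqP.
  have p0a a : p a = 0.
    apply/eqP; rewrite eq_le p0 andbT leNgt; apply/negP => /pM.
    by rewrite M0a ltxx.
  by move: p1; rewrite big1 // => /esym/eqP; rewrite oner_eq0.
have key a : p a * (ln (M a) - ln (p a)) - p a * ln (\sum_a M a) <=
    M a / (\sum_a M a) - p a.
  have := p0 a; rewrite le_eqVlt => /orP[/eqP<-|pa].
    by rewrite !mul0r !subr0 divr_ge0// ltW.
  have Ma := pM a pa.
  have -> : M a / (\sum_a M a) - p a = p a * (M a / (\sum_a M a) / p a - 1).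
    by rewrite mulrBr mulr1 [p a * _]mulrC divfK// gt_eqF.
  rewrite -mulrBr ler_pM2l//.
  have -> : ln (M a) - ln (p a) - ln (\sum_a M a) =
      ln (1 + (M a / (\sum_a M a) / p a - 1)).
    by rewrite [1 + _]addrC subrK !ln_div ?posrE ?divr_gt0// addrAC.
  by apply: le_ln1Dx; rewrite ltrBrDl subrr !divr_gt0.
have : \sum_a (p a * (ln (M a) - ln (p a)) - p a * ln (\sum_a M a)) <=
    \sum_a (M a / (\sum_a M a) - p a) by apply: ler_sum.
by rewrite !sumrB -!mulr_suml p1 mul1r mulfV ?gt_eqF// subrr subr_le0.
Qed.

(* Induction on [F], peeling off the coordinate [t]: the distribution [p] of
   the letter at [t] under the uniform law on [language F S] turns the inductive
   hypotheses for the slices into the claim, by Gibbs' inequality. *)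
Lemma shearer (I : finType) (B : I -> {fset G}) (k : nat) F S : S !=set0 ->
  (forall t, t \in F -> (k <= #|[set i | t \in B i]%SET|)%N) ->
  k%:R * ln (#|language F S|%:R : R) <= \sum_i ln (#|language (B i) S|%:R : R).
Proof.
elim/fset1U_rect: F S => [S S0 _|t F tF IH S S0 kB].
  rewrite (_ : #|language _ _| = 1%N); last first.
    apply/eqP; rewrite eqn_leq card_language_gt0// andbT.
    by rewrite (leq_trans (max_card _))// card_ffun cardfT0 expn0.
  rewrite ln1 mulr0 sumr_ge0// => i _.
  by rewrite ln_ge0// ler1n card_language_gt0.
pose N : R := #|language (t |` F)%fset S|%:R.
pose Na (a : A) : R := #|language F (slice t a S)|%:R.
pose p a := Na a / N.
pose M i a : R := #|language (B i) (slice t a S)|%:R.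
have N0 : 0 < N by rewrite ltr0n card_language_gt0.
have NE : N = \sum_a Na a.
  rewrite /N (@card_language_slices _ _ t) ?fset1U1// natr_sum.
  apply: eq_bigr => a _; congr (_%:R); apply/eqP.
  rewrite eqn_leq card_language_sliceU1 /=.
  by apply: card_image_le => x y _ _ /restrP xy; apply/restrP => u uF;
    apply: xy; rewrite fset1Ur.
have p0 a : 0 <= p a by rewrite divr_ge0// ler0n.
have p1 : \sum_a p a = 1 by rewrite -mulr_suml -NE mulfV// gt_eqF.
have ple1 a : p a <= 1.
  by rewrite -p1 (bigD1 a) //= lerDl sumr_ge0.
have pS a : 0 < p a -> slice t a S !=set0.
  move=> pa; apply/set0P/eqP => S0a.
  move: pa; rewrite /p /Na S0a /language image_set0 eq_card0 ?mul0r ?ltxx//.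
  by move=> q; exact: memNset.
have lnN : ln N = \sum_a p a * (ln (Na a) - ln (p a)).
  rewrite -[LHS]mul1r -p1 mulr_suml; apply: eq_bigr => a _.
  have := p0 a; rewrite le_eqVlt => /orP[/eqP<-|pa]; first by rewrite !mul0r.
  have Na0 : 0 < Na a by move: pa; rewrite /p pmulr_lgt0// invr_gt0.
  by congr (_ * _); rewrite /p ln_div// opprB addrC subrK.
(* If [t] lies in [B i], the slices partition the language and Gibbs' inequality applies; otherwise
   each slice language is just a subset, and averaging suffices. *)
have Mi i : \sum_a p a * (ln (M i a) - (t \in B i)%:R * ln (p a)) <=
    ln (#|language (B i) S|%:R : R).
  case tB: (t \in B i) => /=.
    rewrite (@card_language_slices _ _ t)// natr_sum; under eq_bigr do rewrite mul1r.
    by apply: gibbs => // a pa; rewrite ltr0n card_language_gt0//; exact: pS.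
  rewrite -[leRHS]mul1r -[X in _ <= X * _]p1 mulr_suml; apply: ler_sum => a _.
  rewrite mul0r subr0; have := p0 a; rewrite le_eqVlt => /orP[/eqP<-|pa].
    by rewrite !mul0r.
  have Sa := pS a pa.
  rewrite ler_pM2l// ler_ln; [|by rewrite posrE ltr0n card_language_gt0..].
  by rewrite ler_nat; apply: card_language_sub => x [].
apply: le_trans (ler_sum _ (fun i _ => Mi i)).
rewrite exchange_big /= -/N lnN mulr_sumr; apply: ler_sum => a _.
rewrite -mulr_sumr mulrCA; have := p0 a; rewrite le_eqVlt => /orP[/eqP<-|pa].
  by rewrite !mul0r.
rewrite ler_pM2l// sumrB mulrBr lerB//.
  by apply: IH; [exact: pS|move=> u uF; apply: kB; rewrite fset1Ur].
(* Since [ln (p a) <= 0], a lower bound on how often [t] is covered has the right direction. *)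
rewrite -mulr_suml -natr_sum -big_mkcond sum1_card.
rewrite ler_wnM2r ?ln_le0// ler_nat (leq_trans (kB t (fset1U1 _ _)))//.
by apply/subset_leq_card/fintype.subsetP => i; rewrite inE.
Qed.

End Shearer.

(** * Finite subsets of the group and Folner sequences *)

Section GroupFset.
Variable G : groupType.
Implicit Types (F K T : {fset G}) (c g : G).

Definition rcoset K c : {fset G} := [fset (k * c)%g | k in K]%fset.
Definition invset K : {fset G} := [fset (k^-1)%g | k in K]%fset.

Lemma setmulP K F g :
  reflect (exists k f, [/\ k \in K, f \in F & g = (k * f)%g]) (g \in setmul K F).
Proof.
apply: (iffP (imfset2P _ _ _ _ _)) => [[k kK [f fF ->]]|[k [f [kK fF ->]]]].
  by exists k, f.
by exists k => //; exists f.
Qed.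

Lemma mem_setmul K F k f : k \in K -> f \in F -> (k * f)%g \in setmul K F.
Proof. by move=> kK fF; apply/setmulP; exists k, f. Qed.

Lemma rcosetP K c g : reflect (exists2 k, k \in K & g = (k * c)%g) (g \in rcoset K c).
Proof. by apply: (iffP (imfsetP _ _ _ _)) => -[k kK ->]; exists k. Qed.

Lemma mem_rcoset K c g : (g \in rcoset K c) = ((g * c^-1)%g \in K).
Proof.
apply/rcosetP/idP => [[k kK ->]|gK]; first by rewrite mulgK.
by exists (g * c^-1)%g => //; rewrite mulgVK.
Qed.

Lemma mem_invset K g : (g \in invset K) = ((g^-1)%g \in K).
Proof.
apply/imfsetP/idP => [[k kK ->]|gK]; first by rewrite invgK.
by exists (g^-1)%g => //; rewrite invgK.
Qed.

Lemma card_rcoset K c : #|` rcoset K c| = #|` K|.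
Proof. by rewrite card_imfset//; exact: mulIg. Qed.

Lemma card_invset K : #|` invset K| = #|` K|.
Proof. by rewrite card_imfset//; exact: invg_inj. Qed.

Lemma setmul_neq0 K F : K != fset0 -> F != fset0 -> setmul K F != fset0.
Proof.
move=> /fset0Pn[k kK] /fset0Pn[f fF].
by apply/fset0Pn; exists (k * f)%g; exact: mem_setmul.
Qed.

Lemma invset_neq0 K : K != fset0 -> invset K != fset0.
Proof. by rewrite -!cardfs_gt0 card_invset. Qed.

Lemma card_setmul_symdiff K F :
  (#|` setmul K F| <= #|` F| + #|` symdiff (setmul K F) F|)%N.
Proof.
apply: leq_trans (fsubset_leq_card _) (leq_card_fsetU _ _).
by apply/fsubsetP => g gKF; rewrite !inE gKF; case: (g \in F).
Qed.

Lemma Folner_near (R : realType) (F : nat -> {fset G}) K (e : R) :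
  Folner R F -> K != fset0 -> 0 < e ->
  \forall n \near \oo,
    #|` symdiff (setmul K (F n)) (F n)|%:R <= e * #|` F n|%:R.
Proof.
move=> [F0 FK] K0 e0; have /cvgrPdist_le/(_ e e0) := FK K K0.
apply: filterS => n; rewrite sub0r normrN ger0_norm ?divr_ge0//.
by rewrite ler_pdivrMr// ltr0n cardfs_gt0.
Qed.

End GroupFset.

(** * Entropy as an infimum over windows *)

Section Entropy.
Variables (R : realType) (G : groupType) (A : finType).
Implicit Types (X : set (config G A)) (F K : {fset G}).

Definition invariant X := forall g x, X x -> X (translate g x).

Lemma card_language_rcoset X K c : invariant X ->
  (#|language (rcoset K c) X| <= #|language K X|)%N.
Proof.
move=> inv; pose tr (x : config G A) := restr K (translate c x).
have le1 : (#|language (rcoset K c) X| <= #|tr @` X|)%N.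
  apply: card_image_le => x y _ _ /restrP xy; apply/restrP => u /rcosetP[k kK ->].
  exact: xy.
apply: leq_trans le1 _; apply/subset_leq_card/fintype.subsetP => p; rewrite !inE => -[x Xx <-].
by exists (translate c x) => //; exact: inv.
Qed.

Definition entropy_rate X K : R := ln (#|language K X|%:R : R) / #|` K|%:R.

Lemma entropy_rate_ge0 X K : X !=set0 -> 0 <= entropy_rate X K.
Proof.
by move=> X0; rewrite divr_ge0 ?ln_ge0// ler1n card_language_gt0.
Qed.

(** Shearer's inequality for the translates [K c] with [c] in [K^-1 F]: each [t] in [F] lies in
    those with [c = k^-1 t], one for every [k] in [K]. *)
Lemma entropy_rate_le X K F : X !=set0 -> invariant X ->
  K != fset0 -> F != fset0 ->
  entropy_rate X F <=
    #|` setmul (invset K) F|%:R / #|` F|%:R * entropy_rate X K.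
Proof.
move=> X0 inv K0 F0; set E := setmul (invset K) F.
have cover t : t \in F ->
    (#|` K| <= #|[set c : E | t \in rcoset K (val c)]%SET|)%N.
  move=> tF; have tE (k : K) : ((val k)^-1 * t)%g \in E.
    by apply: mem_setmul => //; rewrite mem_invset invgK (valP k).
  pose f (k : K) : E := [` tE k]%fset.
  have inj : injective f.
    by move=> k l [] /mulIg/invg_inj/val_inj.
  rewrite cardfE -(card_imset _ inj).
  apply/subset_leq_card/fintype.subsetP => c /imsetP[k _ ->].
  by rewrite inE mem_rcoset /= invgM invgK mulVKg (valP k).
have := shearer R X0 cover.
have : \sum_(c : E) ln (#|language (rcoset K (val c)) X|%:R : R) <=
    \sum_(c : E) ln (#|language K X|%:R : R).
  apply: ler_sum => c _.
  rewrite ler_ln ?posrE ?ltr0n ?card_language_gt0// ler_nat.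
  exact: card_language_rcoset.
rewrite sumr_const -cardfE => le1 le2.
have {le1 le2} := le_trans le2 le1; rewrite -[leRHS]mulr_natl => le12.
have K1 : 0 < #|` K|%:R :> R by rewrite ltr0n cardfs_gt0.
have F1 : 0 < #|` F|%:R :> R by rewrite ltr0n cardfs_gt0.
rewrite /entropy_rate mulrAC ler_pM2r ?invr_gt0// mulrA ler_pdivlMr//.
by rewrite mulrC.
Qed.

(* Shearer's inequality makes the limit defining the entropy an infimum over
   all finite windows, so no quasi-tilings are needed for its existence. *)
Lemma htop_exists X : X !=set0 -> invariant X ->
  exists2 h : R, is_htop X h &
    forall K, K != fset0 -> h <= entropy_rate X K.
Proof.
move=> X0 inv; pose V := [set entropy_rate X K | K in [set K | K != fset0]].
have hV : has_inf V.
  split; first by exists (entropy_rate X [fset 1%g]%fset), [fset 1%g]%fset => //=;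
    apply/fset0Pn; exists 1%g; rewrite inE.
  by exists 0 => _ [K _ <-]; exact: entropy_rate_ge0.
have hle K : K != fset0 -> inf V <= entropy_rate X K.
  by move=> K0; apply: ge_inf; [case: hV|exists K].
exists (inf V) => // F FF; apply/cvgrPdist_le => e e0.
have [_ [K /= K0 <-] Kle] := inf_adherent (divr_gt0 e0 (ltr0n _ 2)) hV.
have r0 := entropy_rate_ge0 K X0; set r := entropy_rate X K in Kle r0.
have d0 : 0 < e / 2 / (r + 1) by rewrite !divr_gt0// ltr_wpDl.
have := Folner_near FF (invset_neq0 K0) d0.
apply: filterS => n sn; have Fn0 := FF.1 n.
rewrite -/(entropy_rate X (F n)) distrC ger0_norm ?subr_ge0 ?hle//.
have F1 : 0 < #|` F n|%:R :> R by rewrite ltr0n cardfs_gt0.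
have ratio : #|` setmul (invset K) (F n)|%:R / #|` F n|%:R <= 1 + e / 2 / (r + 1).
  rewrite ler_pdivrMr// mulrDl mul1r; apply: le_trans (lerD (lexx _) sn).
  by rewrite -natrD ler_nat card_setmul_symdiff.
have := entropy_rate_le X0 inv K0 Fn0; rewrite -/r => le1.
have le2 := ler_wpM2r r0 ratio.
have le3 : e / 2 / (r + 1) * r <= e / 2.
  by rewrite mulrAC ler_pdivrMr ?ltr_wpDl// ler_pM2l ?divr_gt0// lerDl.
move: Kle le1 le2 le3; rewrite mulrDl mul1r; lra.
Qed.

End Entropy.

(** * Counting sparse functions *)

Section Counting.
Variable R : realType.

(* Weight every [f] by [lam ^+ #|support|]; the total weight factorizes. *)
Lemma card_sparse_le (I S : finType) (N : nat) (lam : R) : 0 < lam <= 1 ->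
  ln (#|[set f : {ffun I -> option S} | (#|[set i | f i != None]| <= N)%N]%SET|%:R : R)
    <= N%:R * ln lam^-1 + lam * #|S|%:R * #|I|%:R.
Proof.
move=> /andP[lam0 lam1]; set P := [set f | _]%SET.
pose u (o : option S) : R := if o is Some _ then lam else 1.
have le1 : #|P|%:R * lam ^+ N <= (1 + lam * #|S|%:R) ^+ #|I|.
  have -> : (1 + lam * #|S|%:R) ^+ #|I| = \sum_(f : {ffun I -> option S}) \prod_i u (f i).
    rewrite -(bigA_distr_bigA (fun (_ : I) o => u o)) /= prodr_const; congr (_ ^+ _).
    rewrite (bigD1 None) //=; congr (_ + _).
    rewrite (reindex_omap Some id) /=; last by case.
    rewrite (eq_bigl xpredT) => [|s]; last by rewrite eqxx.
    by rewrite sumr_const mulr_natr.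
  rewrite mulr_natl -sumr_const [leRHS](bigID (mem P)) /=.
  apply: ler_wpDr.
    by apply: sumr_ge0 => f _; apply: prodr_ge0 => i _; rewrite /u; case: (f i) => // _; exact: ltW.
  apply: ler_sum => f; rewrite inE => fN.
  rewrite (_ : \prod_i _ = lam ^+ #|[set i | f i != None]%SET|); last first.
    rewrite -prodr_const [RHS]big_mkcond; apply: eq_bigr => i _.
    by rewrite inE /u; case: (f i).
  by rewrite ler_wiXn2l// ltW.
have P0 : 0 < #|P|%:R :> R.
  rewrite ltr0n; apply/card_gt0P; exists [ffun=> None]; rewrite inE.
  by rewrite eq_card0// => i; rewrite !inE ffunE eqxx.
have l0 : 0 <= lam * #|S|%:R by rewrite mulr_ge0// ltW.
have := le1; rewrite -ler_ln ?posrE ?mulr_gt0 ?exprn_gt0 ?ltr_wpDr//.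
rewrite lnM ?posrE ?exprn_gt0// !lnXn ?ltr_wpDr// -[_ *+ N]mulr_natl -[_ *+ #|I|]mulr_natl.
rewrite lnV// mulrN => le2.
have le3 : #|I|%:R * ln (1 + lam * #|S|%:R) <= #|I|%:R * (lam * #|S|%:R).
  by rewrite ler_wpM2l// le_ln1Dx// (lt_le_trans _ l0)// ltrN10.
rewrite addrC lerBrDr [leRHS]mulrC; exact: le_trans le2 le3.
Qed.

End Counting.

(** * Quasi-tilings in finitely many rounds *)

Section QuasiTiling.
Variables (G : groupType) (T : {fset G}).
Implicit Types (U C : set G) (E L : {fset G}).

Definition exposed U (g : G) : {fset G} := [fset t in T | ~~ `[< U (t * g)%g >]]%fset.

Lemma exposedP U g t : reflect (t \in T /\ ~ U (t * g)%g) (t \in exposed U g).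
Proof.
by rewrite !inE /=; apply: (iffP andP) => -[tT]; [move/asboolPn|move=> ?; split=> //; apply/asboolPn].
Qed.

Lemma exposed_sub U V g : U `<=` V -> (#|` exposed V g| <= #|` exposed U g|)%N.
Proof.
move=> UV; apply/fsubset_leq_card/fsubsetP => t /exposedP[tT nV].
by apply/exposedP; split=> // /UV.
Qed.

Definition packing C := forall c c' u, C c -> C c' ->
  u \in rcoset T c -> u \in rcoset T c' -> c = c'.

(** Zorn's lemma applies because packing and the bound [q] both pass to unions of chains; the last
    clause is maximality. *)
Lemma maximal_packing (q : nat) U : (0 < q)%N -> exists C, [/\ packing C,
    forall c, C c -> (q <= #|` exposed U c|)%N &
    forall g, (q <= #|` exposed U g|)%N ->
      exists c u, [/\ C c, u \in rcoset T c & u \in rcoset T g]].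
Proof.
move=> q0; pose P C := packing C /\ forall c, C c -> (q <= #|` exposed U c|)%N.
have [|C [[Cp CE] Cmax]] := @Zorn_bigcup _ P.
  move=> F FP Ft; split; last by move=> c [C /FP[_ CE] /CE].
  move=> c c' u [C FC Cc] [C' FC' Cc'].
  have [CC'|CC'] := Ft _ _ FC FC'.
    exact: (FP _ FC').1 (CC' _ Cc) Cc'.
  exact: (FP _ FC).1 Cc (CC' _ Cc').
exists C; split=> // g gE; apply: contrapT => nC.
have dis c u : C c -> u \in rcoset T c -> u \in rcoset T g -> False.
  by move=> Cc uc ug; apply: nC; exists c, u.
apply: (Cmax (C `|` [set g])).
  split; first by move=> c; left.
  move=> sub; have Cg : C g by apply: sub; right.
  have /fset0Pn[t /exposedP[tT _]] : exposed U g != fset0.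
    by rewrite -cardfs_gt0 (leq_trans q0).
  by apply: (dis g (t * g)%g) => //; apply/rcosetP; exists t.
split; last by move=> c [/CE//|->].
move=> c c' u [Cc|->] [Cc'|->] //; first exact: Cp.
  by move=> uc ug; case: (dis _ _ Cc uc ug).
by move=> ug uc; case: (dis _ _ Cc' uc ug).
Qed.

Definition covered (C : nat -> set G) (k : nat) : set G :=
  [set u | exists j c, [/\ (j < k)%N, C j c & u \in rcoset T c]].

Lemma covered_sub (C : nat -> set G) j k : (j <= k)%N -> covered C j `<=` covered C k.
Proof. by move=> jk u [i [c [ij Cc uc]]]; exists i, c; rewrite (leq_trans ij). Qed.

Definition quasi_tiling (q m : nat) (C : nat -> set G) :=
  [/\ forall k, packing (C k),
      forall k c, C k c -> (q <= #|` exposed (covered C k) c|)%N &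
      forall g, (#|` exposed (covered C m) g| < q)%N].

(** After the earlier of two rounds the tile at [c] is entirely covered, so it cannot have [q > 0]
    exposed points in the later one. *)
Lemma round_unique q (C : nat -> set G) j k c : (0 < q)%N ->
  (forall k c, C k c -> (q <= #|` exposed (covered C k) c|)%N) ->
  C j c -> C k c -> j = k.
Proof.
move=> q0 CE; wlog jk : j k / (j < k)%N => [hw Cj Ck|Cj Ck].
  have [jk|kj|//] := ltngtP j k; first exact: hw jk Cj Ck.
  by rewrite (hw _ _ kj Ck Cj).
have /fset0Pn[t /exposedP[tT]] : exposed (covered C k) c != fset0.
  by rewrite -cardfs_gt0 (leq_trans q0)// CE.
by case; exists j, c; split => //; apply/rcosetP; exists t.
Qed.

(* A point that still sees [q] uncovered elements after all rounds has, for
   each round, met a tile of that round; these tiles are distinct translates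
   meeting a given one, and there are at most [#|T| ^ 2] of those. *)
Lemma quasi_tiling_exists q : (0 < q)%N ->
  exists C : nat -> set G, quasi_tiling q (#|` T| ^ 2).+1 C.
Proof.
move=> q0; have /choice[next nextP] := fun U => maximal_packing U q0.
pose step U := U `|` [set u | exists2 c, next U c & u \in rcoset T c].
pose U k := iter k step set0; pose C k := next (U k).
have UE k : U k = covered C k.
  elim: k => [|k IH]; first by apply/seteqP; split=> u //= -[j [c []]].
  rewrite /U iterS -/(U k) /step {1}IH; apply/seteqP; split=> u.
    case=> [[j [c [jk Cc uc]]]|[c Cc uc]]; last by exists k, c.
    by exists j, c; rewrite ltnS ltnW.
  case=> j [c []]; rewrite ltnS leq_eqVlt => /orP[/eqP-> Cc uc|jk Cc uc].
    by right; exists c.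
  by left; exists j, c.
set m := _.+1; have CE k c : C k c -> (q <= #|` exposed (covered C k) c|)%N.
  by rewrite -UE; have [_ + _] := nextP (U k); apply.
exists C; split=> // [k|g]; first by have [] := nextP (U k).
rewrite ltnNge; apply/negP => gE.
have met (k : 'I_m) : exists c u, [/\ C k c, u \in rcoset T c & u \in rcoset T g].
  have [_ _] := nextP (U k); apply; rewrite UE (leq_trans gE)// exposed_sub//.
  by apply: covered_sub; exact: ltnW.
have {met} /choice[c cP] : forall k : 'I_m, exists c, exists u,
    [/\ C k c, u \in rcoset T c & u \in rcoset T g] by [].
have inj : injective c.
  move=> j k cjk; apply/val_inj => /=.
  have [u [Cj _ _]] := cP j; have [v [Ck _ _]] := cP k; rewrite cjk in Cj.
  exact: round_unique q0 CE Cj Ck.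
have cT k : exists s t : T, c k = ((val s)^-1 * val t * g)%g.
  have [u [_ /rcosetP[s sT ->] /rcosetP[t tT e]]] := cP k.
  by exists [` sT]%fset, [` tT]%fset; rewrite /= -mulgA -e mulKg.
have /choice[f fP] : forall k, exists st : T * T, c k = ((val st.1)^-1 * val st.2 * g)%g.
  by move=> k; have [s [t ->]] := cT k; exists (s, t).
have /leq_card : injective f by move=> j k fjk; apply: inj; rewrite !fP fjk.
by rewrite card_ord card_prod -cardfE mulnn ltnn.
Qed.

Lemma card_fset_sum E (P : pred G) :
  #|` [fset u in E | P u]%fset| = (\sum_(u <- E) P u)%N.
Proof. by rewrite card_fset_sum1 big_fset /= big_mkcond; apply: eq_bigr => u _; case: (P u). Qed.

(** The parts newly covered by the individual tiles are pairwise disjoint, by packing within a round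
    and by exposure across rounds; each has at least [q] points and lies in [T E]. *)
Lemma card_centers q m (C : nat -> set G) E : quasi_tiling q m C ->
  (#|` [fset c in E | `[< exists2 k, (k < m)%N & C k c >]]%fset| * q <= #|` setmul T E|)%N.
Proof.
move=> [Cp CE _]; set E' := [fset c in E | _]%fset.
have /choice[r rP] c : exists k, c \in E' -> C k c.
  have [|nE] := boolP (c \in E'); last by exists 0%N.
  by rewrite !inE => /andP[_ /asboolP[k _ Cc]]; exists k.
pose V c : {fset G} := rcoset (exposed (covered C (r c)) c) c.
have Vsub c u : u \in V c -> u \in rcoset T c.
  by move=> /rcosetP[t /exposedP[tT _] ->]; apply/rcosetP; exists t.
have lt_dis c c' u : c \in E' -> c' \in E' -> (r c < r c')%N ->
    u \in V c -> u \in V c' -> False.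
  move=> cE cE' rcc' uc /rcosetP[t /exposedP[tT nU] eu]; apply: nU.
  by rewrite -eu; exists (r c), c; split=> //; [exact: rP|exact: Vsub].
have disj c c' : c \in E' -> c' \in E' -> c != c' -> [disjoint V c & V c']%fset.
  move=> cE cE' /eqP cc'; apply/fdisjointP => u uc; apply/negP => uc'; apply: cc'.
  have [rr|rr|rr] := ltngtP (r c) (r c').
  - by case: (lt_dis _ _ _ cE cE' rr uc uc').
  - by case: (lt_dis _ _ _ cE' cE rr uc' uc).
  - apply: (Cp (r c) c c' u); [exact: rP|rewrite rr; exact: rP|exact: Vsub|exact: Vsub].
have sub : (\bigcup_(c <- E') V c `<=` setmul T E)%fset.
  apply/bigfcupsP => c; rewrite !inE => /andP[cE _] _; apply/fsubsetP => u /Vsub/rcosetP[t tT ->].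
  exact: mem_setmul.
apply: leq_trans (fsubset_leq_card sub).
rewrite [leqRHS]card_fset_sum1 partition_disjoint_bigfcup// card_fset_sum1 big_distrl /=.
rewrite big_seq [leqRHS]big_seq; apply: leq_sum => c cE.
by rewrite mul1n -card_fset_sum1 card_rcoset; exact: CE (rP _ cE).
Qed.

(** Double counting of the pairs [(t, c)] with [t c] uncovered: an uncovered [u] in [L] yields the
    pair [(t, t^-1 u)] for each [t] in [T], while each [c] lies in fewer than [q] pairs. *)
Lemma card_uncovered q m (C : nat -> set G) L : quasi_tiling q m C ->
  (#|` [fset u in L | ~~ `[< covered C m u >]]%fset| * #|` T| <=
   #|` setmul (invset T) L| * q)%N.
Proof.
move=> [_ _ CU]; set E := setmul _ _.
have le1 t : t \in T -> (#|` [fset u in L | ~~ `[< covered C m u >]]%fset| <=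
    \sum_(c <- E) ~~ `[< covered C m (t * c)%g >])%N.
  move=> tT; rewrite -(card_fset_sum E (fun c => ~~ `[< covered C m (t * c)%g >])).
  have inj : injective (fun u : G => t^-1 * u)%g by exact: mulgI.
  set D := [fset u in L | _]%fset.
  apply: (@leq_trans #|` [fset (t^-1 * u)%g | u in D]%fset|); first by rewrite (card_imfset _ _ inj).
  apply/fsubset_leq_card/fsubsetP => c.
  move=> /imfsetP[u]; rewrite !inE /= => /andP[uL nU] ->.
  by rewrite mulVKg nU andbT mem_setmul// mem_invset invgK.
rewrite mulnC card_fset_sum1 big_distrl /=.
apply: (@leq_trans (\sum_(t <- T) \sum_(c <- E) ~~ `[< covered C m (t * c)%g >])%N).
  by rewrite big_seq [leqRHS]big_seq; apply: leq_sum => t tT; rewrite mul1n le1.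
rewrite exchange_big /= card_fset_sum1 big_distrl /=; apply: leq_sum => c _.
by rewrite mul1n -card_fset_sum ltnW// CU.
Qed.

End QuasiTiling.

(** * Finite type as a condition on one window *)

Section Locality.
Variables (G : groupType) (A : finType).
Implicit Types (X : set (config G A)) (W K : {fset G}) (x y : config G A).

Lemma translateM (g h : G) x : translate g (translate h x) = translate (g * h)%g x.
Proof. by apply/funext => u; rewrite /translate mulgA. Qed.

Lemma translate1 x : translate 1%g x = x.
Proof. by apply/funext => u; rewrite /translate mulg1. Qed.

Definition local W X :=
  forall x, (forall g, language W X (restr W (translate g x))) -> X x.

Lemma language_sub W W' X x : (W `<=` W')%fset ->
  language W' X (restr W' x) -> language W X (restr W x).
Proof.
move=> /fsubsetP sub [y Xy /restrP xy]; exists y => //.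
by apply/restrP => u /sub/xy.
Qed.

(** The window is the union of the supports of the forbidden patterns: one occurring in [x] would
    also occur in a point of [X]. *)
Lemma SFT_local X : SFT X -> exists W, local W X.
Proof.
case=> P finP ->.
have /finite_seqP[s sP] : finite_set ((@projT1 _ _ : pattern G A -> {fset G}) @` P).
  exact: finite_image.
exists (\bigcup_(F <- s) F)%fset => x xloc [p Pp [g _ [c cp cx]]].
have sub : (projT1 p `<=` \bigcup_(F <- s) F)%fset.
  have ps : projT1 p \in s.
    have : [set` s] (projT1 p) by rewrite -sP; exists p.
    by [].
  exact: (bigfcup_sup _ ps).
have [y ny yx] := language_sub sub (xloc (g^-1)%g).
apply: ny; exists p => //; exists 1%g => //; exists y; last exact: translate1.
by rewrite /cylinder /= -cp yx -cx translateM mulVg translate1.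
Qed.

Lemma local_SFT W X : invariant X -> local W X -> SFT X.
Proof.
move=> inv loc.
exists [set existT (fun F : {fset G} => {ffun F -> A}) W q | q in ~` language W X].
  exact: finite_image.
apply/seteqP; split=> x /=.
  move=> Xx [_ [q nq <-] [g _ [c cq cx]]]; apply: nq; exists c => //.
  by rewrite -[c]translate1 -(mulVg g) -translateM cx; exact: inv.
move=> nx; apply: loc => g; apply: contrapT => nL; apply: nx.
exists (existT _ W (restr W (translate g x))); first by exists (restr W (translate g x)).
exists (g^-1)%g => //; exists (translate g x) => //.
by rewrite translateM mulVg translate1.
Qed.

Lemma nbhs_restr W x : nbhs x [set y | restr W y = restr W x].
Proof.
elim/fset1U_rect: W => [|u W uW IH].
  by apply: filterE => y /=; apply/restrP.
have nu : nbhs x [set y | y u = x u].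
  exact: (@proj_continuous G (fun=> discrete_topology A) u x _ (discrete_set1 (x u))).
apply: filterS2 IH nu => y /= /restrP xy xyu; apply/restrP => v.
by rewrite !inE => /orP[/eqP->|/xy].
Qed.

Lemma local_closed W X : invariant X -> local W X -> closed X.
Proof.
move=> inv loc x xX; apply: loc => g.
have [y [Xy /restrP xy]] := xX _ (nbhs_restr (rcoset W g) x).
exists (translate g y); first exact: inv.
by apply/restrP => u uW; apply: xy; apply/rcosetP; exists u.
Qed.

Lemma local_sub W W' X : (W `<=` W')%fset -> local W X -> local W' X.
Proof. by move=> sub loc x xW; apply: loc => g; exact: language_sub (xW g). Qed.

(** * Overwriting the tiles of one round *)

Variables (W T : {fset G}).

(** The inner boundary of [T]. Elements of [W W^-1] carry any point of a window [W g] to any other,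
    so a window with a point of a tile off the frame stays inside that tile. *)
Definition frame : {fset G} :=
  [fset t in T | ~~ (rcoset (setmul W (invset W)) t `<=` T)%fset]%fset.

Lemma frame_interior c g w w' : w \in W -> w' \in W ->
  (w * g)%g \in rcoset T c -> (w * g * c^-1)%g \notin frame ->
  (w' * g)%g \in rcoset T c.
Proof.
move=> wW w'W; rewrite mem_rcoset !inE /= => -> /=; rewrite negbK => /fsubsetP sub.
rewrite mem_rcoset; apply: sub; apply/rcosetP; exists (w' * w^-1)%g.
  by apply: mem_setmul => //; rewrite mem_invset invgK.
by rewrite !mulgA mulgVK.
Qed.

Definition tile_of (C : set G) (u : G) : option G :=
  if pselect (exists c, C c /\ u \in rcoset T c) is left ex
  then Some (projT1 (cid ex)) else None.

Variant tile_of_spec (C : set G) u : option G -> Type :=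
  | InTile c of C c & u \in rcoset T c : tile_of_spec C u (Some c)
  | NoTile of (forall c, C c -> u \notin rcoset T c) : tile_of_spec C u None.

Lemma tile_ofP C u : tile_of_spec C u (tile_of C u).
Proof.
rewrite /tile_of; case: pselect => [ex|nex].
  by case: cid => c /= [Cc uc]; exact: InTile.
by apply: NoTile => c Cc; apply/negP => uc; apply: nex; exists c.
Qed.

Lemma tile_of_eq C c u : packing T C -> C c -> u \in rcoset T c -> tile_of C u = Some c.
Proof.
move=> Cp Cc uc; case: tile_ofP => [c' Cc' uc'|/(_ c Cc)]; last by rewrite uc.
by congr Some; exact: Cp Cc' Cc uc' uc.
Qed.

Definition paint (C : set G) (z : G -> config G A) x : config G A :=
  fun u => if tile_of C u is Some c then z c (u * c^-1)%g else x u.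

(* A window that meets the interior of a tile lies inside that tile; on any
   other window painting changes nothing. *)
Lemma paint_local X C z x : invariant X -> local W X -> packing T C -> X x ->
  (forall c, C c -> X (z c)) ->
  (forall c, C c -> restr frame (z c) = restr frame (translate c x)) ->
  X (paint C z x).
Proof.
move=> inv loc Cp Xx Xz zx; apply: loc => g.
have [[w [c [wW Cc wc nfr]]]|nint] := pselect (exists w c,
    [/\ w \in W, C c, (w * g)%g \in rcoset T c & (w * g * c^-1)%g \notin frame]).
  exists (translate (g * c^-1)%g (z c)); first by apply/inv/Xz.
  apply/restrP => w' w'W; rewrite /translate /paint.
  by rewrite (tile_of_eq Cp Cc (frame_interior wW w'W wc nfr)) mulgA.
exists (translate g x); first exact: inv.
apply/restrP => w wW; rewrite /translate /paint; case: tile_ofP => // c Cc wc.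
have [fr|nfr] := boolP ((w * g * c^-1)%g \in frame); last first.
  by case: nint; exists w, c.
by have /restrP/(_ _ fr) := zx c Cc; rewrite /translate mulgVK.
Qed.

(** * Painting round by round and coding the result *)

Section Rounds.
Variables (X : set (config G A)) (x0 : config G A) (q m : nat) (C : nat -> set G)
  (fill : {ffun frame -> A} -> config G A).
Hypotheses (inv : invariant X) (loc : local W X) (Xx0 : X x0) (q0 : (0 < q)%N)
  (CQ : quasi_tiling T q m C)
  (fillP : forall y, X y ->
     X (fill (restr frame y)) /\ restr frame (fill (restr frame y)) = restr frame y).

Fixpoint painted (k : nat) : config G A :=
  if k is j.+1 then
    paint (C j) (fun c => fill (restr frame (translate c (painted j)))) (painted j)
  else x0.

Lemma painted_mem k : X (painted k).
Proof.
elim: k => [//|k IH] /=; apply: paint_local => // [|c _|c _].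
- by case: CQ.
- exact: (fillP (inv c IH)).1.
- exact: (fillP (inv c IH)).2.
Qed.

Lemma painted_uncovered k u : ~ covered T C k u -> painted k u = x0 u.
Proof.
elim: k => [//|k IH] nU /=; rewrite /paint; case: tile_ofP => [c Cc uc|_].
  by case: nU; exists k, c.
by apply: IH => /(covered_sub (leqnSn k)).
Qed.

(** A center belongs to at most one round, so one entry suffices. The recorded pattern is the one
    seen just before that round, from which the filling is chosen. *)
Definition tile_code (c : G) : option ('I_m * {ffun frame -> A}) :=
  if pselect (exists k : 'I_m, C k c) is left ex then
    let k := projT1 (cid ex) in Some (k, restr frame (translate c (painted k)))
  else None.

Lemma tile_codeP c k b : tile_code c = Some (k, b) <->
  C k c /\ b = restr frame (translate c (painted k)).
Proof.
have [_ CE _] := CQ.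
rewrite /tile_code; case: pselect => [ex|nex]; last first.
  by split=> // -[Ck _]; case: nex; exists k.
case: cid => j /= Cj; split=> [[<- <-]//|[Ck ->]].
by rewrite (val_inj (round_unique q0 CE Cj Ck : val j = val k)).
Qed.

Lemma tile_code_neq0 c : (tile_code c != None) = `[< exists2 k, (k < m)%N & C k c >].
Proof.
rewrite /tile_code; case: pselect => [[k Ck]|nex] /=; apply/esym.
  by apply/asboolP; exists k.
by apply/asboolP => -[k km Ck]; apply: nex; exists (Ordinal km).
Qed.

Definition exposed_code (u : G) : option A :=
  if `[< covered T C m u >] then None else Some (x0 u).

Variable K : {fset G}.

(** The last tile through a point decides its letter, and its filling depends only on the boundary
    pattern coded at its center, which lies in [T^-1 K g]. A point in no tile of the first [m]
    rounds keeps its letter of [x0]. *)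
Lemma painted_determined g h :
  (forall e, e \in setmul (invset T) K -> tile_code (e * g)%g = tile_code (e * h)%g) ->
  (forall u, u \in K -> exposed_code (u * g)%g = exposed_code (u * h)%g) ->
  forall u, u \in K -> painted m (u * g)%g = painted m (u * h)%g.
Proof.
move=> tgh egh u uK; have [Cp _ _] := CQ.
(* A tile of round [k] through [u * g] corresponds to one through [u * h], with
   the same frame. *)
have transfer g' h' (k : 'I_m) c :
    (forall e, e \in setmul (invset T) K -> tile_code (e * g')%g = tile_code (e * h')%g) ->
    C k c -> (u * g')%g \in rcoset T c ->
    exists c', [/\ C k c', (u * h')%g \in rcoset T c',
      (u * h' * c'^-1 = u * g' * c^-1)%g &
      restr frame (translate c' (painted k)) = restr frame (translate c (painted k))].
  move=> gh Cc /rcosetP[t tT ut].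
  have eE : (t^-1 * u)%g \in setmul (invset T) K.
    by apply: mem_setmul => //; rewrite mem_invset invgK.
  have ce : c = (t^-1 * u * g')%g by rewrite -mulgA ut mulKg.
  have /tile_codeP : C k c /\ restr frame (translate c (painted k)) =
    restr frame (translate c (painted k)) by [].
  rewrite {1}ce gh// => /tile_codeP[Cc' eqb].
  exists (t^-1 * u * h')%g; split=> //.
  - by apply/rcosetP; exists t => //; rewrite !mulgA mulgV mul1g.
  - by rewrite ut mulgK !invgM !invgK !mulgA mulgK mulgV mul1g.
have key k : (k <= m)%N -> covered T C k (u * g)%g ->
    painted k (u * g)%g = painted k (u * h)%g.
  elim: k => [|k IH] km; first by case=> j [c []].
  move=> ug /=; rewrite /paint; case: tile_ofP => [c Cc uc|nC].
    have [c' [Cc' uc' e b]] := transfer _ _ (Ordinal km) _ tgh Cc uc.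
    by rewrite (tile_of_eq (Cp k) Cc' uc') /= e; congr (fill _ _); rewrite b.
  (* Exchanging [g] and [h] in [transfer] excludes a tile of this round through [u * h] alone. *)
  case: tile_ofP => [c Cc uc|_].
    have [c' [Cc' uc' _ _]] :=
      transfer h g (Ordinal km) c (fun e eE => esym (tgh e eE)) Cc uc.
    by move: (nC _ Cc'); rewrite uc'.
  apply: IH; first exact: ltnW.
  case: ug => j [c [+ Cc uc]]; rewrite ltnS leq_eqVlt => /orP[/eqP jk|jk].
    by move: (nC c); rewrite -jk uc => /(_ Cc).
  by exists j, c.
have [ug|nug] := pselect (covered T C m (u * g)%g); first exact: key.
have := egh u uK; rewrite /exposed_code; case: asboolP => // _.
case: asboolP => // nuh [x0u].
by rewrite !painted_uncovered.
Qed.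

End Rounds.
End Locality.

(** * Counting the patterns of the painted point *)

Section FewPatterns.
Variables (R : realType) (G : groupType) (A : finType).
Implicit Types (X : set (config G A)) (W K T : {fset G}).

Definition orbit (y : config G A) : set (config G A) :=
  [set translate g y | g in [set: G]].

Lemma card_window K g (P : pred G) :
  (#|[set e : K | P (val e * g)%g]%SET| <= #|` [fset c in rcoset K g | P c]%fset|)%N.
Proof.
set S := [set e : K | _]%SET.
have inj : injective (fun e : K => val e * g)%g by move=> e f /mulIg/val_inj.
apply: (@leq_trans #|` [fset (val e * g)%g | e in S]%fset|).
  by rewrite (card_imfset _ _ inj) /= -cardE.
apply/fsubset_leq_card/fsubsetP => c /imfsetP[e]; rewrite !inE /= => Pe ->.
by rewrite Pe andbT; apply/rcosetP; exists (val e) => //; exact: valP.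
Qed.

(** Two sparse functions code the painted point on each translate of [K]: [card_centers] bounds the
    centers in a translate of [E], [card_uncovered] the exposed letters. The weights of
    [card_sparse_le] stay free. *)
Lemma few_patterns X W T K (q : nat) (lam mu : R) :
  invariant X -> local W X -> X !=set0 -> T != fset0 -> (0 < q)%N ->
  0 < lam <= 1 -> 0 < mu <= 1 ->
  let E := setmul (invset T) K in
  exists2 y, X y &
    ln (#|language K (orbit y)|%:R : R) <=
      (#|` setmul T E| %/ q)%:R * ln lam^-1 +
        lam * ((#|` T| ^ 2).+1 * #|A| ^ #|` frame W T|)%:R * #|` E|%:R +
      ((#|` E| * q %/ #|` T|)%:R * ln mu^-1 + mu * #|A|%:R * #|` K|%:R).
Proof.
move=> inv loc [x0 Xx0] T0 q0 lam01 mu01 E; set m := (_ ^ 2).+1.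
have [C CQ] := quasi_tiling_exists T q0; rewrite -/m in CQ.
(* One filling is fixed for each boundary pattern seen in [X]; the default [x0] serves patterns that
   do not occur. *)
have /choice[fill fillP] (b : {ffun frame W T -> A}) :
    exists z, forall y, X y -> restr (frame W T) y = b ->
      X z /\ restr (frame W T) z = b.
  have [[y [Xy yb]]|ny] := pselect (exists y, X y /\ restr (frame W T) y = b).
    by exists y.
  by exists x0 => y Xy yb; case: ny; exists y.
have {}fillP y : X y -> X (fill (restr (frame W T) y)) /\
    restr (frame W T) (fill (restr (frame W T) y)) = restr (frame W T) y.
  by move=> Xy; exact: fillP Xy erefl.
pose y := painted x0 C fill m.
have Xy : X y by exact: (painted_mem inv loc Xx0 CQ fillP).
exists y => //.
pose N1 := (#|` setmul T E| %/ q)%N; pose N2 := (#|` E| * q %/ #|` T|)%N.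
pose S1 := ('I_m * {ffun frame W T -> A})%type.
pose P1 := [set f : {ffun E -> option S1} | (#|[set i | f i != None]| <= N1)%N]%SET.
pose P2 := [set f : {ffun K -> option A} | (#|[set i | f i != None]| <= N2)%N]%SET.
pose D1 := tile_code x0 m C fill.
pose D2 := exposed_code T x0 m C.
pose code g := ([ffun e : E => D1 (val e * g)%g], [ffun u : K => D2 (val u * g)%g]).
have codeP g : code g \in finset.setX P1 P2.
  rewrite inE /=; apply/andP; split; rewrite inE.
    rewrite (_ : finset _ = [set e : E | D1 (val e * g)%g != None]%SET); last first.
      by apply/setP => e; rewrite !inE ffunE.
    apply: leq_trans (card_window _ _ (fun c => D1 c != None)) _.
    rewrite leq_divRL//; apply: (@leq_trans #|` setmul T (rcoset E g)|).
      apply: leq_trans (card_centers (rcoset E g) CQ).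
      rewrite leq_mul2r; apply/orP; right; apply/fsubset_leq_card/fsubsetP => c.
      by rewrite !inE /D1 tile_code_neq0.
    rewrite -(card_rcoset (setmul T E) g); apply/fsubset_leq_card/fsubsetP => u.
    case/setmulP => t [_ [tT /rcosetP[e eE ->] ->]].
    by apply/rcosetP; exists (t * e)%g; [exact: mem_setmul|rewrite mulgA].
  rewrite (_ : finset _ = [set u : K | D2 (val u * g)%g != None]%SET); last first.
    by apply/setP => u; rewrite !inE ffunE.
  apply: leq_trans (card_window _ _ (fun c => D2 c != None)) _.
  rewrite leq_divRL ?cardfs_gt0//.
  apply: (@leq_trans (#|` setmul (invset T) (rcoset K g)| * q)%N).
    apply: leq_trans (card_uncovered (rcoset K g) CQ).
    rewrite leq_mul2r; apply/orP; right; apply/fsubset_leq_card/fsubsetP => c.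
    by rewrite !inE /D2 /exposed_code; case: asboolP.
  rewrite leq_mul2r; apply/orP; right.
  rewrite -(card_rcoset E g); apply/fsubset_leq_card/fsubsetP => u.
  case/setmulP => t [_ [tT /rcosetP[e eE ->] ->]].
  by apply/rcosetP; exists (t * e)%g; [exact: mem_setmul|rewrite mulgA].
have le1 : (#|language K (orbit y)| <= #|P1| * #|P2|)%N.
  rewrite -cardsX; pose pat g := restr K (translate g y).
  have le2 : (#|pat @` [set: G]| <= #|code @` [set: G]|)%N.
    apply: card_image_le => g h _ _ [/ffunP e1 /ffunP e2]; apply/restrP => u uK.
    apply: (painted_determined q0 CQ _ _ uK) => [e eE|v vK].
      by have := e1 [` eE]%fset; rewrite !ffunE.
    by have := e2 [` vK]%fset; rewrite !ffunE.
  apply: leq_trans (leq_trans le2 _); apply/subset_leq_card/fintype.subsetP => p.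
    by rewrite !inE => -[_ [g _ <-] <-]; exists g.
  by rewrite inE => -[g _ <-]; exact: codeP.
have L0 : (0 < #|language K (orbit y)|)%N.
  by apply: card_language_gt0; exists (translate 1%g y), 1%g.
have /andP[P10 P20] : (0 < #|P1|)%N && (0 < #|P2|)%N.
  by rewrite -muln_gt0 (leq_trans L0).
apply: (@le_trans _ _ (ln #|P1|%:R + ln #|P2|%:R)).
  by rewrite -lnM ?posrE ?ltr0n// -natrM ler_ln ?posrE ?ltr0n ?muln_gt0 ?P10// ler_nat.
apply: lerD.
  have := card_sparse_le E S1 N1 lam01.
  by rewrite card_prod card_ord card_ffun -!cardfE.
by have := card_sparse_le K A N2 mu01; rewrite -!cardfE.
Qed.

End FewPatterns.

(** * Choice of tile, window and constants *)

Section LowEntropy.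
Variables (R : realType) (G : groupType).
Hypotheses (Ginf : infinite_set [set: G]) (Gamen : amenable R G).
Implicit Types (K T D W : {fset G}).

(** A frame point [t] has some [d] in [W W^-1] with [d t] outside [T]; for fixed [d] these [d t] are
    distinct points of the symmetric difference. *)
Lemma card_frame W T : (#|` frame W T| <= #|` setmul W (invset W)| *
    #|` symdiff (setmul (setmul W (invset W)) T) T|)%N.
Proof.
set D := setmul W _; rewrite /frame card_fset_sum.
apply: (@leq_trans (\sum_(t <- T) \sum_(d <- D) ((d * t)%g \notin T))%N).
  apply: leq_sum => t _; case: fsubsetPn => [/= [_ /rcosetP[d dD ->] dt]|//].
  by rewrite (big_fsetD1 _ dD) /= dt.
rewrite exchange_big /= card_fset_sum1 big_distrl /= big_seq [leqRHS]big_seq.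
apply: leq_sum => d dD; rewrite mul1n -(card_fset_sum T (fun t => (d * t)%g \notin T)).
set F := [fset t in T | _]%fset.
apply: (@leq_trans #|` [fset (d * t)%g | t in F]%fset|).
  by rewrite (card_imfset _ _ (@mulgI G d)).
apply/fsubset_leq_card/fsubsetP => _ /imfsetP[t + ->]; rewrite !inE /= => /andP[tT dt].
by rewrite dt mem_setmul.
Qed.

Lemma card_setmul_ge K T : T != fset0 -> (#|` K| <= #|` setmul K T|)%N.
Proof.
move=> /fset0Pn[t tT]; rewrite -(card_rcoset K t); apply/fsubset_leq_card/fsubsetP.
by move=> u /rcosetP[k kK ->]; exact: mem_setmul.
Qed.

Lemma Folner_ex2 (F : nat -> {fset G}) K L (d e : R) : Folner R F ->
  K != fset0 -> L != fset0 -> 0 < d -> 0 < e -> exists n,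
    #|` symdiff (setmul K (F n)) (F n)|%:R <= d * #|` F n|%:R /\
    #|` symdiff (setmul L (F n)) (F n)|%:R <= e * #|` F n|%:R.
Proof.
move=> FF K0 L0 d0 e0; near \oo => n; exists n; split; near: n; exact: Folner_near.
Unshelve. all: by end_near. Qed.

(** Infinitude of [G] makes the tile large: some [K] has more than [2 M] elements, and a Folner set
    [T] nearly invariant under [K] has [#|K| <= #|K T| <= 2 #|T|]. *)
Lemma large_invariant_tile (M : nat) D (e : R) : D != fset0 -> 0 < e ->
  exists T, [/\ T != fset0, (M <= #|` T|)%N &
    #|` symdiff (setmul D T) T|%:R <= e * #|` T|%:R].
Proof.
move=> D0 e0; have [F FF] := Gamen.
have [K _ Kcard] := infinite_set_fset (M.*2.+1) Ginf.
have K0 : K != fset0 by rewrite -cardfs_gt0 (leq_trans _ Kcard).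
have [n [FD FK]] := Folner_ex2 FF D0 K0 e0 (@ltr01 R).
exists (F n); split=> //; first exact: FF.1.
move: FK; rewrite mul1r ler_nat => FK.
have := leq_trans (card_setmul_ge K (FF.1 n)) (card_setmul_symdiff K (F n)).
by move: Kcard FK; lia.
Qed.

Lemma invariant_window T : T != fset0 -> exists K, [/\ K != fset0,
  (#|` setmul (invset T) K| <= 2 * #|` K|)%N &
  (#|` setmul T (setmul (invset T) K)| <= 2 * #|` K|)%N].
Proof.
move=> T0; have [F FF] := Gamen; have iT0 := invset_neq0 T0.
have [n [F1 F2]] := Folner_ex2 FF iT0 (setmul_neq0 T0 iT0) (@ltr01 R) (@ltr01 R).
move: F1 F2; rewrite !mul1r !ler_nat => F1 F2.
have setmulA K L M : setmul K (setmul L M) = setmul (setmul K L) M :> {fset G}.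
  apply/fsetP => u; apply/setmulP/setmulP.
    move=> [k [_ [kK /setmulP[l [m [lL mM ->]]] ->]]].
    by exists (k * l)%g, m; rewrite mulgA mem_setmul.
  move=> [_ [m [/setmulP[k [l [kK lL ->]]] mM ->]]].
  by exists k, (l * m)%g; rewrite mulgA mem_setmul.
exists (F n); split; first exact: FF.1.
  by apply: leq_trans (card_setmul_symdiff _ _) _; lia.
by rewrite setmulA; apply: leq_trans (card_setmul_symdiff _ _) _; lia.
Qed.

Lemma ln_le_scale (x r : R) : 0 < x -> 0 < r -> ln x <= x / r + ln r.
Proof.
by move=> x0 r0; rewrite -lerBlDr -ln_div// ltW// ln_sublinear// divr_gt0.
Qed.

(** Per point of [K], the first of the four terms in [few_patterns], the cost of placing the
    centers, is allotted [eps / 2] and each other term [eps / 8]. *)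
Lemma low_entropy_orbit (A : finType) (X : set (config G A)) W (eps : R) :
  invariant X -> local W X -> X !=set0 -> 0 < eps ->
  exists y K, [/\ X y, K != fset0 & entropy_rate R (orbit y) K <= eps].
Proof.
move=> inv locW X0 eps0.
wlog W0 : W locW / W != fset0.
  move=> hw; apply: (hw (1%g |` W)%fset).
    by apply: local_sub locW; exact: fsubsetU1.
  by apply/fset0Pn; exists 1%g; rewrite fset1U1.
have A0 : (0 < #|A|)%N by case: X0 => x _; apply/card_gt0P; exists (x 1%g).
pose a : R := #|A|%:R; have a1 : 1 <= a by rewrite ler1n.
have al0 : 0 <= ln a by exact: ln_ge0.
(* These control the terms linear in [lam] and [mu]; adding [1] keeps both weights at most [1]. *)
pose r1 := 1 + 16 / eps; pose r2 := 1 + 8 * a / eps.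
have r11 : 1 <= r1 by rewrite lerDl divr_ge0// ltW.
have r21 : 1 <= r2 by rewrite lerDl divr_ge0 ?mulr_ge0// ?ltW// (lt_le_trans ltr01).
(* [1 / Q] plays the role of [delta], small enough to offset [ln r2 = ln mu^-1], the cost of each
   exposed letter. *)
have [Q [Q0 Qr2]] : exists Q : nat, (0 < Q)%N /\ 32 * ln r2 / eps <= Q%:R.
  exists (Num.trunc (32 * ln r2 / eps)).+1; split => //.
  by rewrite ltW// truncnS_gt.
have Q0r : 0 < Q%:R :> R by rewrite ltr0n.
(* With at most [2 Q / #|T|] centers per point of [K], a cost of [4 c #|T|] each adds up to
   [eps / 2]. *)
pose c := eps / (16 * Q%:R).
have c0 : 0 < c by rewrite divr_gt0// mulr_gt0.
pose r3 := 1 + 4 / c.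
have r31 : 1 <= r3 by rewrite lerDl divr_ge0// ltW.
pose D := setmul W (invset W).
have D0 : D != fset0 by rewrite setmul_neq0// invset_neq0.
have Dpos : 0 < #|` D|%:R :> R by rewrite ltr0n cardfs_gt0.
(* The frame becomes so thin that its patterns cost at most [c #|T|] per tile; [1 + ln a] also
   covers the one-letter alphabet. *)
pose e := c / (#|` D|%:R * (1 + ln a)).
have e0 : 0 < e by rewrite divr_gt0// mulr_gt0// ltr_wpDr.
pose M := (Q + (Num.trunc ((2 * ln r3 + ln r1) / c)).+1)%N.
have [T [T0 MT symT]] := large_invariant_tile M D0 e0.
pose t : R := #|` T|%:R.
have QT : (Q <= #|` T|)%N by rewrite (leq_trans _ MT)// leq_addr.
have t1 : 1 <= t by rewrite ler1n (leq_trans Q0).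
have tr : 2 * ln r3 + ln r1 <= c * t.
  rewrite [leRHS]mulrC -ler_pdivrMr//; apply: (@le_trans _ _ (Num.trunc ((2 * ln r3 + ln r1) / c)).+1%:R).
    by rewrite ltW// truncnS_gt.
  by rewrite ler_nat (leq_trans _ MT)// leq_addl.
pose f : R := #|` frame W T|%:R.
have fa : f * ln a <= c * t.
  have : f <= #|` D|%:R * (e * t).
    apply: (@le_trans _ _ (#|` D|%:R * #|` symdiff (setmul D T) T|%:R)).
      by rewrite -natrM ler_nat card_frame.
    by rewrite ler_pM2l.
  move=> fle; apply: (@le_trans _ _ (#|` D|%:R * (e * t) * (1 + ln a))).
    by apply: ler_pM => //; rewrite lerDr.
  have -> : #|` D|%:R * (e * t) * (1 + ln a) = c * t; last by [].
  by rewrite /e; field; rewrite ?gt_eqF// ltr_wpDr.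
have [K [K0 EK TEK]] := invariant_window T0.
pose k : R := #|` K|%:R.
have kpos : 0 < k by rewrite ltr0n cardfs_gt0.
(* The successor gives [#|T| < q Q], used for the centers; [Q <= #|T|] gives [q Q <= 2 #|T|], used
   for the exposed points. *)
pose q := (#|` T| %/ Q).+1.
pose s := ((#|` T| ^ 2).+1 * #|A| ^ #|` frame W T|)%N.
have s0 : (0 < s)%N by rewrite muln_gt0 /= expn_gt0 A0.
have s0r : 0 < s%:R :> R by rewrite ltr0n.
have r10 : 0 < r1 by rewrite (lt_le_trans ltr01).
have r20 : 0 < r2 by rewrite (lt_le_trans ltr01).
have r30 : 0 < r3 by rewrite (lt_le_trans ltr01).
pose lam := (s%:R * r1)^-1; pose mu := r2^-1.
have lam01 : 0 < lam <= 1.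
  by rewrite invr_gt0 mulr_gt0//= invf_le1 ?mulr_gt0// mulr_ege1// ler1n.
have mu01 : 0 < mu <= 1 by rewrite invr_gt0 r20/= invf_le1.
have [y Xy] := few_patterns K inv locW X0 T0 (ltn0Sn _ : (0 < q)%N) lam01 mu01.
set E := setmul (invset T) K in EK TEK *.
set N1 := (_ %/ q)%N; set N2 := (_ %/ #|` T|)%N; rewrite -/s -/a -/k => bound.
exists y, K; split=> //; rewrite /entropy_rate ler_pdivrMr// -/k.
apply: le_trans bound _.
have N1b : N1%:R * t <= 2 * k * Q%:R.
  rewrite -!natrM ler_nat; apply: (@leq_trans (N1 * q * Q)).
    by rewrite -mulnA leq_mul2l ltnW ?orbT// ltn_ceil.
  by rewrite leq_mul2r (leq_trans (leq_trunc_div _ _) TEK) orbT.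
have N2b : N2%:R * Q%:R <= 4 * k.
  rewrite -!natrM ler_nat -(@leq_pmul2r #|` T|) ?cardfs_gt0//.
  rewrite mulnAC; apply: (@leq_trans (#|` E| * q * Q)).
    by rewrite leq_mul2r leq_trunc_div orbT.
  rewrite -mulnA (_ : 4 * _ * _ = 2 * #|` K| * (2 * #|` T|))%N; last by rewrite mulnACA mulnA.
  apply: leq_mul => //; rewrite mul2n -addnn /q mulSn leq_add//.
  exact: leq_trunc_div.
have lnlam : ln lam^-1 <= 4 * c * t.
  rewrite invrK lnM ?posrE// natrM natrX lnM ?posrE ?ltr0n ?exprn_gt0 ?ltr0n//.
  rewrite lnXn; last by rewrite ltr0n.
  rewrite -/a -[ln a *+ _]mulr_natl -/f.
  have t10 : 0 < t + 1 by rewrite ltr_wpDl// (le_trans _ t1).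
  have lnm : ln ((#|` T| ^ 2).+1%:R : R) <= 2 * ln (t + 1).
    rewrite mulr_natl -lnXn// ler_ln ?posrE ?ltr0n ?exprn_gt0//.
    rewrite -natr1 natrX -/t; nra.
  have := ln_le_scale t10 r30.
  have : (t + 1) / r3 <= c * t / 2.
    rewrite ler_pdivrMr//.
    have : 4 <= c * r3 by rewrite /r3 mulrDr mulr1 mulrCA mulfV ?gt_eqF// mulr1 lerDr ltW.
    nra.
  have : 0 <= c * t by rewrite mulr_ge0 ?(le_trans _ t1)// ltW.
  move: tr fa lnm; lra.
have b1 : N1%:R * ln lam^-1 <= k * (eps / 2).
  apply: (@le_trans _ _ (N1%:R * (4 * c * t))); first by have := ler_wpM2l (ler0n R N1) lnlam.
  rewrite (_ : N1%:R * (4 * c * t) = N1%:R * t * (4 * c)); last by ring.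
  apply: (@le_trans _ _ (2 * k * Q%:R * (4 * c))).
    by rewrite ler_wpM2r// mulr_ge0// ltW.
  rewrite (_ : 2 * k * Q%:R * (4 * c) = k * (eps / 2))// /c.
  by field; rewrite gt_eqF.
have b2 : lam * s%:R * #|` E|%:R <= k * (eps / 8).
  have -> : lam * s%:R = r1^-1 by rewrite /lam invfM mulrAC mulVf ?gt_eqF// mul1r.
  rewrite ler_pdivrMl//.
  have : #|` E|%:R <= 2 * k :> R by rewrite -natrM ler_nat.
  have : 16 <= r1 * eps by rewrite /r1 mulrDl mul1r divfK ?gt_eqF// lerDr ltW.
  nra.
have b3 : N2%:R * ln mu^-1 <= k * (eps / 8).
  rewrite invrK.
  have lr2 : ln r2 <= Q%:R * eps / 32.
    by move: Qr2; rewrite ler_pdivrMr// => ?; lra.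
  apply: (@le_trans _ _ (N2%:R * (Q%:R * eps / 32))); first by have := ler_wpM2l (ler0n R N2) lr2.
  move: N2b eps0; nra.
have b4 : mu * a * k <= k * (eps / 8).
  rewrite mulrC ler_pM2l// /mu ler_pdivrMl//.
  have -> : r2 * (eps / 8) = eps / 8 + a by rewrite /r2; field; rewrite gt_eqF.
  by rewrite lerDr divr_ge0// ltW.
move: b1 b2 b3 b4 kpos eps0; nra.
Qed.

End LowEntropy.

(* [G] is countably infinite: for finite [G] the claim fails, e.g. for
   [G = Z/6], [H = S_3] (the regular [G]-action carries a free chart of [S_3],
   but small entropy forces a one-point [Y], hence an embedding of [H] in [G]). *)
Theorem corollary3p20 (R : realType) (G H : groupType)
    (Gcount : countable [set: G]) (Ginf : infinite_set [set: G])
    (Gamen : amenable R G) (Hcount : countable [set: H]) :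
  (exists (A : finType) (X : set (config G A))
          (gamma : discrete_topology H * config G A -> discrete_topology G),
      [/\ SFT X, X !=set0 & free_chart X gamma]) ->
  forall eps : R, 0 < eps ->
  exists (B : finType) (Y : set (config G B))
         (gamma' : discrete_topology H * config G B -> discrete_topology G),
    [/\ SFT Y, Y !=set0, free_chart Y gamma' &
        exists2 h : R, is_htop Y h & h <= eps].
Proof.
move=> [A [X [gamma [SX X0 [[[_ inv] [gcont g1 gM]] gfree]]]]] eps eps0.
have [W loc] := SFT_local SX.
have [y [K [Xy K0 yK]]] := low_entropy_orbit Ginf Gamen inv loc X0 eps0.
pose Y := [set x | X x /\ forall g, language K (orbit y) (restr K (translate g x))].
have YX : Y `<=` X by move=> x [].
have invY : invariant Y.
  by move=> g x [Xx xK]; split=> [|h]; [exact: inv|rewrite translateM].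
have locY : local (W `|` K)%fset Y.
  move=> x xWK; split.
    apply: loc => g; have [z [Xz _] xz] := language_sub (fsubsetUl W K) (xWK g).
    by exists z.
  move=> g; have [z [_ zK] xz] := language_sub (fsubsetUr W K) (xWK g).
  by rewrite -xz -[z]translate1.
have Yy : Y y by split=> // g; exists (translate g y) => //; exists g.
have Y0 : Y !=set0 by exists y.
exists A, Y, gamma; split=> //.
- exact: local_SFT locY.
- split; last by move=> x /YX; exact: gfree.
  split; first by split; [exact: local_closed locY|].
  split; [|by move=> x /YX; exact: g1|by move=> h1 h2 x /YX; exact: gM].
  by apply: continuous_subspaceW gcont => -[h x] [? /YX]; split.
(* Every [K]-pattern of [Y] occurs in the orbit of [y], so the rate of [Y] on [K], which bounds [h],
   is at most that of the orbit. *)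
- have [h hY hle] := htop_exists R Y0 invY.
  exists h => //; apply: le_trans (hle K K0) (le_trans _ yK).
  rewrite ler_pM2r ?invr_gt0 ?ltr0n ?cardfs_gt0//.
  rewrite ler_ln ?posrE ?ltr0n ?card_language_gt0//; last first.
    by exists (translate 1%g y), 1%g.
  rewrite ler_nat; apply/subset_leq_card/fintype.subsetP => p; rewrite !inE.
  by move=> [x [_ xK] <-]; rewrite -[x]translate1.
Qed.
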